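(* Let $X$ be a bounded commutative BCK-algebra, and let $\Im$ and $\Im'$ be the Baig topologies on $X$-modules $M$ and $M'$ admitted by decreasing sequences of submodules $(M_n)_{n\in\mathbb{Z}^+}$ of $M$ and $(M'_n)_{n\in\mathbb{Z}^+}$ of $M'$ respectively. Let $f:M\to M'$ be a compatible $X$-homomorphism. Then $f$ is strict if and only if for all $n\in\mathbb{Z}^+$ the associated mapping $\alpha_n:\operatorname{Ker} f\to\operatorname{Ker} f_n$ is an $X$-epimorphism.
   Context: A BCK-algebra is a set $X$ with a binary operation $*$ and a constant $0$ such that for all $a,b,c\in X$: $((a*b)*(a*c))*(c*b)=0$; $(a*(a*b))*b=0$; $a*a=0$; $0*a=0$; and $a*b=0=b*a$ implies $a=b$. Write $a\le b$ iff $a*b=0$ (a partial order), and $a\wedge b=b*(b*a)$. $X$ is bounded if it has an element $1$ with $a\le 1$ for all $a\in X$, and commutative if $a\wedge b=b\wedge a$ for all $a,b\in X$. For a bounded commutative BCK-algebra $X$, an $X$-module is an abelian group $(M,+)$ with a map $X\times M\to M$, $(a,m)\mapsto am$, such that $(a\wedge b)m=a(bm)$, $a(m_1+m_2)=am_1+am_2$, $0m=0$ and $1m=m$ for all $a,b\in X$, $m,m_1,m_2\in M$. A submodule is a subgroup $N$ of $M$ that is an $X$-module under the same action; the factor module $M/N$ is the quotient group with action $a(m+N)=am+N$. An $X$-homomorphism $f:M\to M'$ is a map with $f(m_1+m_2)=f(m_1)+f(m_2)$ and $f(xm)=xf(m)$ for all $x\in X$, $m,m_1,m_2\in M$; an $X$-epimorphism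 is a surjective $X$-homomorphism. Kernels are taken in the usual sense. A decreasing sequence of submodules of $M$ is a family $(M_n)_{n\in\mathbb{Z}^+}$ of submodules with $M_{n+1}\subseteq M_n$ for all $n$. The Baig topology on $M$ admitted by it is $\{V\subseteq M : \forall v\in V\ \exists n\in\mathbb{Z}^+ \text{ such that } v+M_n\subseteq V\}$. An $X$-homomorphism $f:M\to M'$ is compatible (with the Baig topologies) if $f(M_n)\subseteq M'_n$ for all $n\in\mathbb{Z}^+$, and strict if $f(M_n)=f(M)\cap M'_n$ for all $n\in\mathbb{Z}^+$. For compatible $f$ and $n\in\mathbb{Z}^+$, $f_n:M/M_n\to M'/M'_n$ is the $X$-homomorphism $f_n(m+M_n)=f(m)+M'_n$, and $\alpha_n:\operatorname{Ker} f\to\operatorname{Ker} f_n$ is the $X$-homomorphism $\alpha_n(k)=k+M_n$. *)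

(* Defs.v *)
From HB Require Import structures.
From mathcomp Require Import all_boot all_algebra ring_quotient generic_quotient.
From mathcomp Require Import boolp classical_sets.

Set Implicit Arguments.
Unset Strict Implicit.
Unset Printing Implicit Defensive.

Import GRing.Theory ring_quotient.Quotient.

Declare Scope bck_scope.
Delimit Scope bck_scope with bck.
Local Open Scope classical_set_scope.
Local Open Scope ring_scope.
Local Open Scope quotient_scope.
Local Open Scope bck_scope.

Reserved Notation "a ** b" (at level 40, left associativity).
Reserved Notation "{ 'xhom' U -> V }"
  (U at level 98, V at level 99, format "{ 'xhom'  U  ->  V }").

HB.mixin Record isBCK (X : Type) := {
  bck_zero : X;
  bck_op : X -> X -> X;
  bck_trans_subproof : forall a b c,
    bck_op (bck_op (bck_op a b) (bck_op a c)) (bck_op c b) = bck_zero;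
  bck_opK_subproof : forall a b, bck_op (bck_op a (bck_op a b)) b = bck_zero;
  bck_opxx_subproof : forall a, bck_op a a = bck_zero;
  bck_op0x_subproof : forall a, bck_op bck_zero a = bck_zero;
  bck_anti_subproof : forall a b,
    bck_op a b = bck_zero -> bck_op b a = bck_zero -> a = b
}.

#[short(type="bckType")]
HB.structure Definition BCK := {X of isBCK X}.

Notation "a ** b" := (bck_op a b) : bck_scope.

Definition bck_le (X : bckType) (a b : X) : Prop := a ** b = bck_zero.

Definition bck_meet (X : bckType) (a b : X) : X := b ** (b ** a).

HB.mixin Record isBoundedBCK X of BCK X := {
  bck_one : X;
  bck_le1_subproof : forall a : X, bck_le a bck_one
}.

HB.mixin Record isCommutativeBCK X of BCK X := {
  bck_meetC_subproof : forall a b : X, bck_meet a b = bck_meet b a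
}.

#[short(type="bcBckType")]
HB.structure Definition BoundedCommutativeBCK :=
  {X of BCK X & isBoundedBCK X & isCommutativeBCK X}.

HB.mixin Record Zmodule_isXmodule (X : bcBckType) M of GRing.Zmodule M := {
  act : X -> M -> M;
  act_meet : forall (a b : X) (m : M), act (bck_meet a b) m = act a (act b m);
  actDr : forall (a : X) (m1 m2 : M), act a (m1 + m2) = act a m1 + act a m2;
  act0x : forall m : M, act bck_zero m = 0;
  act1x : forall m : M, act bck_one m = m
}.

#[short(type="xmodType")]
HB.structure Definition Xmodule (X : bcBckType) :=
  {M of GRing.Zmodule M & Zmodule_isXmodule X M}.

Section XmoduleTheory.
Context {X : bcBckType} {M : xmodType X}.
Implicit Types (a : X) (m : M).

Lemma actx0 a : act a (0 : M) = 0.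
Proof. by apply: (addrI (act a 0)); rewrite -actDr !addr0. Qed.

Lemma actNr a m : act a (- m) = - act a m.
Proof. by apply: (addrI (act a m)); rewrite -actDr !subrr actx0. Qed.

Lemma actBr a m1 m2 : act a (m1 - m2) = act a m1 - act a m2.
Proof. by rewrite actDr actNr. Qed.

End XmoduleTheory.

HB.mixin Record isActClosed (X : bcBckType) (M : xmodType X) (N : M -> bool) := {
  rpred_act_subproof : forall (a : X) (m : M), m \in N -> act a m \in N
}.

#[short(type="submodule")]
HB.structure Definition Submodule (X : bcBckType) (M : xmodType X) :=
  {N of GRing.ZmodClosed M N & isActClosed X M N}.

Lemma rpred_act (X : bcBckType) (M : xmodType X) (N : submodule M) (a : X) (m : M) :
  m \in N -> act a m \in N.
Proof. exact: rpred_act_subproof. Qed.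

Section SubmoduleType.
Context {X : bcBckType} {M : xmodType X}.
Variable N : submodule M.

Inductive submod_of : predArgType := Submod m & m \in N.

Definition submod_val (u : submod_of) : M := let: Submod m _ := u in m.

HB.instance Definition _ := [isSub of submod_of for submod_val].
HB.instance Definition _ := [Choice of submod_of by <:].
HB.instance Definition _ := [SubChoice_isSubZmodule of submod_of by <:].

Definition submod_act (a : X) (u : submod_of) : submod_of :=
  Submod (rpred_act a (valP u)).

Fact submod_act_meet a b u :
  submod_act (bck_meet a b) u = submod_act a (submod_act b u).
Proof. by apply: val_inj; rewrite /= act_meet. Qed.

Fact submod_actDr a u1 u2 :
  submod_act a (u1 + u2) = submod_act a u1 + submod_act a u2.
Proof. by apply: val_inj; rewrite /= actDr. Qed.

Fact submod_act0x u : submod_act bck_zero u = 0.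
Proof. by apply: val_inj; rewrite /= act0x. Qed.

Fact submod_act1x u : submod_act bck_one u = u.
Proof. by apply: val_inj; rewrite /= act1x. Qed.

HB.instance Definition _ := Zmodule_isXmodule.Build X submod_of
  submod_act_meet submod_actDr submod_act0x submod_act1x.

End SubmoduleType.

Section FactorModule.
Context {X : bcBckType} {M : xmodType X}.
Variable N : submodule M.

Lemma eq_cosetP (m1 m2 : M) :
  \pi_{quot N} m1 = \pi_{quot N} m2 <-> m1 - m2 \in N.
Proof. by split=> [/eqP|h]; [|apply/eqP]; rewrite -idealrBE. Qed.

Definition quot_act (a : X) (q : {quot N}) : {quot N} :=
  \pi_{quot N} (act a (repr q)).

Lemma quot_act_pi a m : quot_act a (\pi_{quot N} m) = \pi_{quot N} (act a m).
Proof.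
by apply/eq_cosetP; rewrite -actBr; apply: rpred_act; apply/eq_cosetP; rewrite reprK.
Qed.

Fact quot_act_meet a b q :
  quot_act (bck_meet a b) q = quot_act a (quot_act b q).
Proof. by rewrite -[q]reprK quot_act_pi act_meet -!quot_act_pi. Qed.

Fact quot_actDr a q1 q2 :
  quot_act a (q1 + q2) = quot_act a q1 + quot_act a q2.
Proof.
by rewrite -[q1]reprK -[q2]reprK -raddfD !quot_act_pi actDr raddfD.
Qed.

Fact quot_act0x q : quot_act bck_zero q = 0.
Proof. by rewrite -[q]reprK quot_act_pi act0x raddf0. Qed.

Fact quot_act1x q : quot_act bck_one q = q.
Proof. by rewrite -[q]reprK quot_act_pi act1x. Qed.

HB.instance Definition _ := Zmodule_isXmodule.Build X {quot N}
  quot_act_meet quot_actDr quot_act0x quot_act1x.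

End FactorModule.

HB.mixin Record isActMorphism (X : bcBckType) (M M' : xmodType X) (f : M -> M') := {
  raddf_act_subproof : forall (a : X) (m : M), f (act a m) = act a (f m)
}.

#[short(type="xhom")]
HB.structure Definition Xhom (X : bcBckType) (M M' : xmodType X) :=
  {f of @GRing.isNmodMorphism M M' f & isActMorphism X M M' f}.

Notation "{ 'xhom' U -> V }" := (xhom U%type V%type) : type_scope.

Lemma raddf_act (X : bcBckType) (M M' : xmodType X) (f : {xhom M -> M'})
  (a : X) (m : M) : f (act a m) = act a (f m).
Proof. exact: raddf_act_subproof. Qed.

Definition x_epimorphism (X : bcBckType) (M M' : xmodType X)
  (f : {xhom M -> M'}) : Prop := forall m', exists m, f m = m'.

Section Kernel.
Context {X : bcBckType} {M M' : xmodType X}.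
Variable f : {xhom M -> M'}.

Definition xker : {pred M} := [pred m | f m == 0].

Fact xker_zmod_closed : zmod_closed xker.
Proof.
split=> [|x y]; rewrite !inE ?raddf0// => /eqP fx /eqP fy.
by rewrite raddfB /= fx fy subr0.
Qed.
HB.instance Definition _ := GRing.isZmodClosed.Build M xker xker_zmod_closed.

Fact xker_act_closed (a : X) (m : M) : m \in xker -> act a m \in xker.
Proof. by rewrite !inE raddf_act => /eqP ->; rewrite actx0. Qed.
HB.instance Definition _ := isActClosed.Build X M xker xker_act_closed.

End Kernel.

Section InducedMap.
Context {X : bcBckType} {M M' : xmodType X}.
Variables (f : {xhom M -> M'}) (N : submodule M) (N' : submodule M').
Implicit Type fN : f @` [set` N] `<=` [set` N'].

(* The value does not mention fN, which is only what makes it independent of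
   the representative (see quot_map_pi). *)
Definition quot_map fN (q : {quot N}) : {quot N'} := \pi_{quot N'} (f (repr q)).

Lemma quot_map_pi fN m : quot_map fN (\pi_{quot N} m) = \pi_{quot N'} (f m).
Proof.
apply/eq_cosetP; rewrite -raddfB; apply: fN; exists (repr (\pi_{quot N} m) - m) => //.
by apply/eq_cosetP; rewrite reprK.
Qed.

Fact quot_map_nmod_morphism fN : nmod_morphism (quot_map fN).
Proof.
split=> [|q1 q2]; first by rewrite -(raddf0 \pi_{quot N}) quot_map_pi !raddf0.
by rewrite -[q1]reprK -[q2]reprK -raddfD !quot_map_pi !raddfD.
Qed.
HB.instance Definition _ fN := GRing.isNmodMorphism.Build {quot N} {quot N'}
  (quot_map fN) (quot_map_nmod_morphism fN).

Fact quot_map_act fN (a : X) q : quot_map fN (act a q) = act a (quot_map fN q).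
Proof.
rewrite -[q]reprK /act /= quot_act_pi !quot_map_pi quot_act_pi.
by rewrite -raddf_act.
Qed.
HB.instance Definition _ fN := isActMorphism.Build X {quot N} {quot N'}
  (quot_map fN) (quot_map_act fN).

Fact alpha_subproof fN (k : submod_of (xker f)) :
  \pi_{quot N} (val k) \in xker (quot_map fN).
Proof.
case: k => k kf; rewrite inE /= quot_map_pi.
by move: kf; rewrite inE => /eqP ->; rewrite raddf0.
Qed.

Definition alpha fN (k : submod_of (xker f)) : submod_of (xker (quot_map fN)) :=
  Submod (alpha_subproof fN k).

Fact alpha_nmod_morphism fN : nmod_morphism (alpha fN).
Proof. by split=> [|k1 k2]; apply: val_inj; rewrite /= ?raddf0 ?raddfD. Qed.
HB.instance Definition _ fN := GRing.isNmodMorphism.Build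
  (submod_of (xker f)) (submod_of (xker (quot_map fN)))
  (alpha fN) (alpha_nmod_morphism fN).

Fact alpha_act fN (a : X) k : alpha fN (act a k) = act a (alpha fN k).
Proof. by apply: val_inj; rewrite /= [RHS]quot_act_pi. Qed.
HB.instance Definition _ fN := isActMorphism.Build X
  (submod_of (xker f)) (submod_of (xker (quot_map fN)))
  (alpha fN) (alpha_act fN).

End InducedMap.

(* Sequences are indexed by the positive integers: the value at 0 of a
   sequence nat -> submodule M is never used. *)
Section Sequences.
Context {X : bcBckType} {M M' : xmodType X}.
Variables (Ms : nat -> submodule M) (Ms' : nat -> submodule M').

Definition decreasing_submodules : Prop :=
  forall n, (0 < n)%N -> [set` Ms n.+1] `<=` [set` Ms n].

Definition baig_topology : set (set M) :=
  [set V | forall v, V v ->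
     exists2 n, (0 < n)%N & [set v + m | m in [set` Ms n]] `<=` V].

Definition compatible (f : {xhom M -> M'}) : Prop :=
  forall n, (0 < n)%N -> f @` [set` Ms n] `<=` [set` Ms' n].

Definition strict (f : {xhom M -> M'}) : Prop :=
  forall n, (0 < n)%N -> f @` [set` Ms n] = range f `&` [set` Ms' n].

End Sequences.

Section BaigTopology.
Context {X : bcBckType} {M : xmodType X}.
Variable Ms : nat -> submodule M.

Lemma baig_topologyT : baig_topology Ms setT.
Proof. by move=> v _; exists 1%N. Qed.

Lemma baig_topology_bigcup (I : Type) (D : set I) (V : I -> set M) :
  (forall i, D i -> baig_topology Ms (V i)) ->
  baig_topology Ms (\bigcup_(i in D) V i).
Proof.
move=> VD v [i Di Vv]; have [n n0 nV] := VD i Di v Vv.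
by exists n => // _ [m mN <-]; exists i => //; apply: nV; exists m.
Qed.

Lemma decreasing_submodules_le : decreasing_submodules Ms ->
  forall n p, (0 < n <= p)%N -> [set` Ms p] `<=` [set` Ms n].
Proof.
move=> dec n p /andP[n0]; elim: p => [|p IH]; first by rewrite leqn0 => /eqP ->.
rewrite leq_eqVlt => /predU1P[->//|np] m /(dec _ (leq_trans n0 np)).
exact: IH.
Qed.

Lemma baig_topologyI : decreasing_submodules Ms -> forall V W,
  baig_topology Ms V -> baig_topology Ms W -> baig_topology Ms (V `&` W).
Proof.
move=> dec V W hV hW v [/hV[n n0 nV] /hW[p p0 pW]].
exists (maxn n p) => [|_ [m mN <-]]; first by rewrite leq_max n0.
split; [apply: nV | apply: pW]; exists m => //.
- by apply: (decreasing_submodules_le dec _ mN); rewrite n0 leq_maxl.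
- by apply: (decreasing_submodules_le dec _ mN); rewrite p0 leq_maxr.
Qed.

End BaigTopology.

(* Main.v *)
Require Import Defs.
From mathcomp Require Import all_boot all_algebra.
From mathcomp Require Import boolp classical_sets.
From mathcomp Require Import ring_quotient generic_quotient.

(** Fix submodules [N] of [M] and [N'] of [M'] with [f(N)] inside [N'].  Both
    sides of the equivalence unfold to the same condition, the inclusion of
    [f^-1(N')] in [Ker f + N].
    For strictness: [f m] lies in [f(N)] exactly when [m] differs from an
    element of [N] by an element of [Ker f].
    For surjectivity of [alpha]: the kernel of the induced map
    [M/N -> M'/N'] is [f^-1(N')/N], and the image of [Ker f] in [M/N] is
    [(Ker f + N)/N].
    The theorem is this fact at each index [n > 0]. *)

Import GRing.Theory ring_quotient.Quotient.
Local Open Scope classical_set_scope.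
Local Open Scope ring_scope.
Local Open Scope quotient_scope.

Section OneSubmodule.
Set Implicit Arguments.
Unset Strict Implicit.
Context {X : bcBckType} {M M' : xmodType X}.
Context (f : {xhom M -> M'}) (N : submodule M) (N' : submodule M').
Context (fN : f @` [set` N] `<=` [set` N']).

(** The inclusion of [f^-1(N')] in [Ker f + N], with the element of [Ker f] as
    the witness, since it is what a preimage under [alpha] has to be. *)
Definition preim_sub_ker_add : Prop :=
  forall m, f m \in N' -> exists2 k, k \in xker f & m - k \in N.

(** Two elements of [M] have the same image exactly when they differ by an
    element of [Ker f], so [f m] lies in [f(N)] if and only if [m] lies in
    [Ker f + N]. *)
Lemma strict_at_preimP :
  f @` [set` N] = range f `&` [set` N'] <-> preim_sub_ker_add.
Proof.
split=> [fNE m fmN' | dec].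
  have : (f @` [set` N]) (f m) by rewrite fNE; split=> //; exists m.
  case=> n nN fnE; exists (m - n); last by rewrite subKr.
  by rewrite inE raddfB /= fnE subrr.
apply/seteqP; split=> [m' fNm' | _ [[m _ <-] /dec[k + mkN]]].
  by split; [case: fNm' => n _ <-; exists n | exact: fN].
by rewrite inE => /eqP fk0; exists (m - k) => //; rewrite raddfB /= fk0 subr0.
Qed.

(** This identifies the kernel of the induced map with [f^-1(N')/N]: the coset
    of [m] is sent to that of [f m], which vanishes when [f m] is in [N']. *)
Lemma mem_xker_quot_map m :
  (\pi_{quot N} m \in xker (quot_map fN)) = (f m \in N').
Proof.
have -> : (\pi_{quot N} m \in xker (quot_map fN)) =
    (\pi_{quot N'} (f m) == \pi_{quot N'} 0).
  by rewrite inE /= quot_map_pi raddf0.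
by apply/eqP/idP => [/eq_cosetP | fmN']; last apply/eq_cosetP; rewrite subr0.
Qed.

(** A coset [m + N] in the kernel of the induced map is the value of [alpha] at
    [k] exactly when [m - k] lies in [N]. *)
Lemma alpha_epi_preimP : x_epimorphism (alpha fN) <-> preim_sub_ker_add.
Proof.
split=> [epi m | dec [q qker]].
  rewrite -mem_xker_quot_map => qker.
  have [[k kker] /(congr1 val) /= kE] := epi (Submod qker).
  by exists k => //; apply/eq_cosetP.
have := qker; rewrite -[q in q \in _]reprK mem_xker_quot_map.
move=> /dec[k kker mkN]; exists (Submod kker); apply: val_inj => /=.
by rewrite -[RHS]reprK; apply/esym/eq_cosetP.
Qed.

End OneSubmodule.

Theorem theorem3p17 (X : bcBckType) (M M' : xmodType X)
  (Ms : nat -> submodule M) (Ms' : nat -> submodule M')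
  (Ms_decreasing : decreasing_submodules Ms)
  (Ms'_decreasing : decreasing_submodules Ms')
  (Im : set (set M)) (Im' : set (set M'))
  (Im_baig : Im = baig_topology Ms) (Im'_baig : Im' = baig_topology Ms')
  (f : {xhom M -> M'}) (f_compatible : compatible Ms Ms' f) :
  strict Ms Ms' f <->
  (forall (n : nat) (n_gt0 : (0 < n)%N),
     x_epimorphism (alpha (f_compatible n n_gt0))).
Proof.
split=> [fstrict n n_gt0 | epi n n_gt0].
  apply/alpha_epi_preimP/(strict_at_preimP (f_compatible n n_gt0)).
  exact: fstrict.
apply/(strict_at_preimP (f_compatible n n_gt0)).
exact: (alpha_epi_preimP _).1 (epi n n_gt0).
Qed.
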